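(* Let $A=\{0,1\}$, let $(A^{\mathbb{Z}},F)$ be a one-dimensional cellular automaton of radius $r$, and let $\omega$ be a region of $n$ consecutive cells. Then $(A^{\mathbb{Z}},F)$ is regional controllable (on $\omega$) if and only if the $2$-approximation $\mathcal{A}_2(\tau_F^n)$ of the $n$-trace of $F$ is transitive.
   Context: A cellular automaton of radius $r\ge 1$ is given by a local rule $f:A^{2r+1}\to A$ and $F(s)_i=f(s_{i-r},\dots,s_{i+r})$. For a finite word $z\in A^{n+2r}$, $F(z)\in A^n$ denotes the word obtained by applying $f$ at the $n$ central positions. Regional controllability: configurations of the region $\omega=\{c_1,\dots,c_n\}$ are identified with words in $A^n$. A word $u\in A^n$ is reachable from $w\in A^n$ in one step if there is a boundary control $(x,y)\in (A^r)^2$ with $F(xwy)=u$, where $xwy$ is the concatenation. A word $u$ is reachable from $w$ at time $T$ if there are words $w=w^0,w^1,\dots,w^T=u$ in $A^n$ with each $w^{i+1}$ reachable from $w^i$ in one step. The CA is regional controllable on $\omega$ if for every $s^0_\omega,s^d_\omega\in A^\omega$ there is a time $T$ such that $s^d_\omega$ is reachable from $s^0_\omega$ at time $T$. The $n$-trace $\tau_F^n$ of $F$ is the one-sided subshift over the alphabet $A^n$ of the columns of width $n$ of the space-time diagrams: $\tau_F^n=\{(F^t(s)_{[0,n)})_{t\in\mathbb{N}} : s\in A^{\mathbb{Z}}\}$. For a subshift $\Sigma$, $\mathcal{L}_k(\Sigma)$ is the set of words of length $k$ appearing in its points, and the $k$-approximation $\mathcal{A}_k(\Sigma)$ is the subshift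 of finite type of all sequences $s$ (over the same alphabet and index set) all of whose factors $s_{[i,i+k)}$ of length $k$ belong to $\mathcal{L}_k(\Sigma)$. A subshift of finite type is called transitive if its associated graph is strongly connected; for $\mathcal{A}_2(\Sigma)$ the graph has the letters as vertices and an edge $u\to v$ iff $uv\in\mathcal{L}_2(\Sigma)$. *)

(* Defs.v *)
From Stdlib Require Import Relation_Operators.
From mathcomp Require Import all_boot ssralg ssrint.

Set Implicit Arguments.
Unset Strict Implicit.
Unset Printing Implicit Defensive.

Section CellularAutomata.

Variables (A : finType) (r : nat).

Definition local_rule := (2 * r).+1.-tuple A -> A.

Definition config := int -> A.

Variable f : local_rule.

Definition ca_map (s : config) : config :=
  fun i => f [tuple s (i - Posz r + Posz j)%R | j < (2 * r).+1].

Lemma window_subproof n (i : 'I_n) (j : 'I_(2 * r).+1) : i + j < r + (n + r).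
Proof.
by rewrite addnCA addnn -mul2n -addSn leq_add // -ltnS.
Qed.

(* The length n + 2r is written r + (n + r) so that it is, up to conversion,
   the length of a concatenation x ++ w ++ y with x, y of length r.  Position
   i of the result is cell r + i of z, whose window starts at i. *)
Definition word_map n (z : (r + (n + r)).-tuple A) : n.-tuple A :=
  [tuple f [tuple tnth z (Ordinal (window_subproof i j)) | j < (2 * r).+1]
   | i < n].

Definition reachable1 n (w u : n.-tuple A) : Prop :=
  exists x y : r.-tuple A, word_map [tuple of x ++ w ++ y] = u.

Definition reachable n (T : nat) (w u : n.-tuple A) : Prop :=
  exists c : nat -> n.-tuple A,
    [/\ c 0 = w, c T = u & forall i, i < T -> reachable1 (c i) (c i.+1)].

(* The notion is translation invariant, so that the region enters only through
   its number n of consecutive cells. *)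
Definition regional_controllable n : Prop :=
  forall s0 sd : n.-tuple A, exists T, reachable T s0 sd.

Definition trace n (x : nat -> n.-tuple A) : Prop :=
  exists s : config,
    forall t, x t = [tuple iter t ca_map s (Posz i) | i < n].

End CellularAutomata.

Section Subshifts.

Variable B : finType.

Definition factor (s : nat -> B) (i k : nat) : k.-tuple B :=
  [tuple s (i + j) | j < k].

Definition language k (Sigma : (nat -> B) -> Prop) (u : k.-tuple B) : Prop :=
  exists2 s, Sigma s & exists i, factor s i k = u.

(* A one-sided subshift of finite type of order k, presented by its allowed
   words of length k; it coerces to the set of its points. *)
Record sft (k : nat) := Sft { allowed : k.-tuple B -> Prop }.

Definition sft_points k (X : sft k) (s : nat -> B) : Prop :=
  forall i, allowed X (factor s i k).

Definition approximation k (Sigma : (nat -> B) -> Prop) : sft k :=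
  Sft (@language k Sigma).

Definition sft_graph (X : sft 2) (u v : B) : Prop := allowed X [tuple u; v].

Definition strongly_connected (e : B -> B -> Prop) : Prop :=
  forall u v, clos_refl_trans B e u v.

Definition sft_transitive (X : sft 2) : Prop :=
  strongly_connected (sft_graph X).

End Subshifts.

Coercion sft_points : sft >-> Funclass.

(* Main.v *)
(* The word F^t(s) on [-r, n+r) is a word x w y, so two consecutive letters of
   the n-trace are a word w and a word reachable from w in one step.
   Conversely any x w y extends to a configuration, whose trace starts with w
   followed by F(x w y).  Hence the graph of the 2-approximation is the one-step
   reachability relation, and its paths are the controlled trajectories. *)
Require Import Defs.
From Stdlib Require Import Relation_Operators.
From mathcomp Require Import all_boot ssralg ssrint zify.

Section TraceGraph.

Variables (A : finType) (r : nat) (f : local_rule A r).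

Definition block (s : config A) n : (r + (n + r)).-tuple A :=
  [tuple s (Posz k - Posz r)%R | k < r + (n + r)].

Lemma word_map_block (s : config A) n :
  word_map f (block s n) = [tuple ca_map f s (Posz i) | i < n].
Proof.
apply: eq_from_tnth => i; rewrite !tnth_mktuple; congr f.
by apply: eq_from_tnth => j; rewrite !tnth_mktuple /=; congr s; lia.
Qed.

Lemma block_cat (s : config A) n :
  block s n = [tuple of [tuple s (Posz i - Posz r)%R | i < r] ++
                        [tuple s (Posz i) | i < n] ++
                        [tuple s (Posz (n + i)) | i < r]].
Proof.
apply: eq_from_tnth => k; rewrite tnth_mktuple.
rewrite -(splitK k); case: (split k) => [i|k'] /=.
  by rewrite tnth_lshift tnth_mktuple.
rewrite tnth_rshift -(splitK k'); case: (split k') => [i|i] /=.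
  by rewrite tnth_lshift tnth_mktuple; congr s; lia.
by rewrite tnth_rshift tnth_mktuple; congr s; lia.
Qed.

Lemma block_surj (a : A) n (z : (r + (n + r)).-tuple A) :
  exists s, block s n = z.
Proof.
(* Only cells with c + r in [0, n + 2r) matter, and there [absz] is the identity. Elsewhere the
   values are arbitrary, [a] being the default past the end of [z]. *)
exists (fun c => nth a z (absz (c + Posz r)%R)).
apply: eq_from_tnth => k; rewrite tnth_mktuple (tnth_nth a).
by congr nth; lia.
Qed.

Lemma trace_edgeP (a : A) n (u v : n.-tuple A) :
  sft_graph (approximation 2 (@trace A r f n)) u v <-> reachable1 f u v.
Proof.
split.
  case=> c [s cE] [t cuv].
  have tnth_uv (j : 'I_2) : c (t + j) = tnth [tuple u; v] j.
    by rewrite -cuv tnth_mktuple.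
  have /= uE := tnth_uv ord0; have /= vE := tnth_uv (lift ord0 ord0).
  rewrite addn0 cE (tnth_nth u) /= in uE.
  rewrite addn1 cE (tnth_nth u) /= in vE.
  (* The pair [u], [v] may occur at any time t, so the controls are read off F^t(s), next to the
     region. *)
  rewrite -uE -vE -word_map_block block_cat.
  by do 2 eexists.
case=> x [y <-].
have [s sE] := block_surj a n [tuple of x ++ u ++ y].
exists (fun t => [tuple iter t (ca_map f) s (Posz i) | i < n]); first by exists s.
exists 0; apply: eq_from_tnth => j; rewrite tnth_mktuple.
have [-> | ->] : j = ord0 \/ j = lift ord0 ord0.
  by case: j => -[|[|//]] ?; [left | right]; apply: val_inj.
(* Cell i sits at position r + i of [x ++ u ++ y], that is, at position i of [u]. *)
- apply: eq_from_tnth => i; rewrite tnth_mktuple /=.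
  have := congr1 (fun z => tnth z (rshift r (lshift r i))) sE.
  rewrite tnth_rshift tnth_lshift tnth_mktuple => <- /=.
  by congr s; lia.
- by rewrite -sE word_map_block.
Qed.

(** Since T is free, trajectories of all lengths count: the empty one gives reflexivity, and
    concatenation gives transitivity. *)
Lemma reachable_rtP n (u v : n.-tuple A) :
  (exists T, reachable f T u v) <-> clos_refl_trans _ (@reachable1 A r f n) u v.
Proof.
split.
  case=> T [c [<- <-]]; elim: T => [_|T IH step]; first exact: rt_refl.
  apply: (rt_trans _ _ _ (c T)); first by apply: IH => i /ltnW/step.
  exact/rt_step/step.
elim=> [{}u {}v uv | {}u | {}u w {}v _ [S [c [c0 cS c_step]]] _
          [T [d [d0 dT d_step]]]].
- by exists 1, (fun t => if t is 0 then u else v); split=> // -[].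
- by exists 0, (fun=> u).
(* At time S the second trajectory already takes over; this is consistent because [c S] and [d 0]
   are both [w]. *)
exists (S + T), (fun t => if t < S then c t else d (t - S)); split.
- case: S c0 cS {c_step} => //= c0 cS.
  by rewrite subnn d0 -cS c0.
- by rewrite ltnNge leq_addr addKn.
move=> i lt_i; case: (ltngtP i.+1 S) => [ltS | gtS | eqS].
- by apply: c_step; apply: ltnW.
- by rewrite subSn //; apply: d_step; lia.
(* At the junction, the last step of [c] must land on [d 0], which equals [c S]. *)
- by rewrite -eqS subnn d0 -cS -eqS; apply: c_step; rewrite -eqS.
Qed.

End TraceGraph.

Lemma clos_refl_trans_mono (B : Type) (e e' : B -> B -> Prop) (u v : B) :
  (forall x y, e x y -> e' x y) ->
  clos_refl_trans B e u v -> clos_refl_trans B e' u v.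
Proof.
move=> ee'; elim=> [x y /ee' | x | x y z _ xy _ yz].
- exact: rt_step.
- exact: rt_refl.
- exact: rt_trans xy yz.
Qed.

Theorem proposition3p11 (r n : nat) (hr : 1 <= r) (hn : 1 <= n)
    (f : local_rule bool r) :
  regional_controllable f n <->
  sft_transitive (approximation 2 (@trace bool r f n)).
Proof.
split=> [ctrl u v | trans u v].
  move: (ctrl u v) => /reachable_rtP; apply: clos_refl_trans_mono => x y.
  (* [false] is the default letter for extending a word to a configuration. *)
  by move/(trace_edgeP _ _ f false).
apply/reachable_rtP; apply: clos_refl_trans_mono (trans u v) => x y.
by move/(trace_edgeP _ _ f false).
Qed.
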